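(* Let $\Gamma$ be a countable group acting on a compact space $K$ by homeomorphisms and let $F\subset K$ be a finite subset. Then either there is a finite orbit of $\Gamma$ on $K$, or there is an element $g\in\Gamma$ sending $F$ disjoint from itself (i.e. $g(F)\cap F=\emptyset$). *)

(* Defs.v *)
From mathcomp Require Import all_boot all_order all_algebra.
From mathcomp Require Import all_classical topology.

Set Implicit Arguments.
Unset Strict Implicit.
Unset Printing Implicit Defensive.

Local Open Scope classical_set_scope.

(* Left actions of an arbitrary group; fingroup.action only treats right
   actions of finite groups. *)
Definition left_action (G : groupType) (T : Type) (act : G -> T -> T) : Prop :=
  (forall x, act 1%g x = x) /\
  (forall g h x, act (g * h)%g x = act g (act h x)).

Definition homeomorphism (S T : topologicalType) (f : S -> T) : Prop :=
  continuous f /\ exists f' : T -> S, [/\ continuous f', cancel f f' & cancel f' f].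

Definition acts_by_homeomorphisms (G : groupType) (T : topologicalType)
    (act : G -> T -> T) : Prop :=
  left_action act /\ forall g, homeomorphism (act g).

Definition act_orbit (G : groupType) (T : Type) (act : G -> T -> T) (x : T) : set T :=
  [set act g x | g in [set: G]].

(* Main.v *)
Require Import Defs.
From mathcomp Require Import all_boot all_order all_algebra.
From mathcomp Require Import all_classical topology.

(** This is an instance of P. M. Neumann's separation lemma for group actions
    ([infinite_orbits_separation]): a finite set [A] of points with infinite
    orbits can be moved off any finite set [B].  If the action has no finite
    orbit, take [A = B = F].

    The separation lemma is proved by induction on [A], for all [B] at once.
    To add a point [a] to [A], pick [h] with [c = h a] outside [B], which is
    possible because the orbit of [a] is infinite; for every [b] in [B] lying
    on that orbit choose [k b] with [k b c = b]; and move [A] off the finite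
    set [B' = B] together with all the translates [k b B], by some [g].  If
    [g a] is not in [B], then [g] also works for [a].  Otherwise
    [b = g a] is in [B], and [(k b)^-1 g] works: it sends [a] to [c], and it
    moves [A] off [B] because [g] moves [A] off [k b B]. *)

Local Open Scope classical_set_scope.

Lemma left_actionK (G : groupType) (T : Type) (act : G -> T -> T) :
  left_action act -> forall g, cancel (act g) (act g^-1%g).
Proof. by move=> [act1 actM] g x; rewrite -actM mulVg act1. Qed.

Lemma left_actionVK (G : groupType) (T : Type) (act : G -> T -> T) :
  left_action act -> forall g, cancel (act g^-1%g) (act g).
Proof. by move=> [act1 actM] g x; rewrite -actM mulgV act1. Qed.

Lemma infinite_orbits_separation (G : groupType) (T : choiceType)
    (act : G -> T -> T) (A : seq T) (B : set T) :
  left_action act -> finite_set B ->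
  (forall a, a \in A -> infinite_set (act_orbit act a)) ->
  exists g : G, forall a, a \in A -> ~ B (act g a).
Proof.
move=> actP; have [_ actM] := actP.
elim: A B => [|a A IHA] B finB infA; first by exists 1%g.
have [c [[h _ hac] NBc]] : exists c, act_orbit act a c /\ ~ B c.
  apply: contrapT => NorbB; apply: (infA a (mem_head a A)).
  apply: sub_finite_set finB => c orb_c.
  by apply: contrapT => NBc; apply: NorbB; exists c.
(* Off the orbit of [c], [k] takes the irrelevant default value 1. *)
pose k b := xget 1%g [set l : G | act l c = b].
have kE l : act (k (act l c)) c = act l c.
  by rewrite /k; case: xgetP => [m _ // | Nl]; case: (Nl l).
have finB' : finite_set (B `|` \bigcup_(b in B) (act (k b) @` B)).
  rewrite finite_setU; split=> //.
  by apply: bigcup_finite => // b _; apply: finite_image.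
have [a' A_a'|g gA] := IHA _ finB'.
  by apply: infA; rewrite in_cons A_a' orbT.
have [Bga|NBga] := pselect (B (act g a)); last first.
  exists g => x; rewrite in_cons => /orP[/eqP-> // | xA Bgx].
  by apply: (gA x xA); left.
exists ((k (act g a))^-1 * g)%g => x; rewrite in_cons actM => /orP[/eqP-> | xA Bx].
  have gaE : act g a = act (g * h^-1)%g c by rewrite actM -hac left_actionK.
  by rewrite [X in act _ X]gaE -kE -gaE left_actionK.
apply: (gA x xA); right; exists (act g a) => //.
by exists (act (k (act g a))^-1%g (act g x)) => //; rewrite left_actionVK.
Qed.

Theorem lemma1p6 (Gamma : groupType) (K : topologicalType)
    (act : Gamma -> K -> K) (F : set K)
    (Gamma_countable : countable [set: Gamma])
    (K_compact : compact [set: K])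
    (act_homeo : acts_by_homeomorphisms act)
    (F_finite : finite_set F) :
  (exists x : K, finite_set (act_orbit act x)) \/
  (exists g : Gamma, (act g @` F) `&` F = set0).
Proof.
have [actP _] := act_homeo.
have [fin_orb|Nfin_orb] := pselect (exists x, finite_set (act_orbit act x)).
  by left.
right; have /finite_seqP[s Fs] := F_finite.
have [|g gF] := @infinite_orbits_separation _ _ act s F actP F_finite.
  by move=> x _ fin_x; apply: Nfin_orb; exists x.
exists g; apply/seteqP; split=> // _ [[x Fx <-] Fgx].
by apply: (gF x) => //; rewrite Fs in Fx.
Qed.
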